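(* There is an absolute constant $c>0$ such that the following holds. Let $p$ be a prime, $r\ge1$ an integer, and $A,B\subset\mathbb{F}_p$ nonempty, where $A$ has distinct consecutive $r$--differences. Then either $A+B=\mathbb{F}_p$ or $$|A+B|\ge c\, e^{-r(\log 2+1)}\,|A|\,|B|^{1/(r+1)}.$$
   Context: Elements of $\mathbb{F}_p$ are ordered according to their least nonnegative integer representatives, so $A=\{a_1<\dots<a_k\}$ in this order. $A$ has distinct consecutive $r$--differences if the $r$-tuples $(a_{i+1}-a_i,\dots,a_{i+r}-a_{i+r-1})$ (differences computed in $\mathbb{F}_p$), $1\le i\le k-r$, are pairwise distinct. $A+B=\{a+b:a\in A,b\in B\}$. *)

(* Defs.v *)
From HB Require Import structures.
From mathcomp Require Import all_boot all_order all_algebra.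

Set Implicit Arguments.
Unset Strict Implicit.
Unset Printing Implicit Defensive.

Import GRing.Theory.
Local Open Scope ring_scope.

(* For p prime, the natural number underlying an element of 'F_p is its least
   nonnegative representative. *)
Definition increasing_seq (p : nat) (A : {set 'F_p}) : seq 'F_p :=
  sort (fun x y : 'F_p => (x <= y)%N) (enum A).

(* Indices start at 0: with k = #|A|, the elements a_1 < ... < a_k of A sit at
   positions 0, ..., k - 1. *)
Definition consecutive_diff (p : nat) (A : {set 'F_p}) (i : nat) : 'F_p :=
  (increasing_seq A)`_i.+1 - (increasing_seq A)`_i.

Definition consecutive_diffs (p r : nat) (A : {set 'F_p}) (i : nat) :
    r.-tuple 'F_p :=
  [tuple consecutive_diff A (i + j) | j < r].

(* The truncated subtraction makes the condition vacuous when #|A| <= r. *)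
Definition distinct_consecutive_diffs (p r : nat) (A : {set 'F_p}) : Prop :=
  forall i j : nat, (i < #|A| - r)%N -> (j < #|A| - r)%N ->
    consecutive_diffs r A i = consecutive_diffs r A j -> i = j.

Definition sumset (p : nat) (A B : {set 'F_p}) : {set 'F_p} :=
  [set a + b | a in A, b in B].

(* Main.v *)
(* For x in C = A + B, rank the elements of C by their position after x in
   the cyclic order.  For b in B and i < |A| - r, the tuple
   (a_i + b, ..., a_(i+r) + b) lies in C and determines (i, b), because its
   consecutive differences determine i.  For fixed b the half-open cyclic
   intervals from a_i + b to a_(i+r) + b cover each element of C at most r
   times, so for at least half of the i such an interval meets C in at most
   L = 2 r |C| / (|A| - r) elements.  A tuple with that property is given by
   its first element and r ranks below L, whence
   (|A| - r) |B| <= 2 |C| L^r.  When |A| <= 2 r, the bound |B| <= |C| is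
   enough. *)
Require Import Defs.
From mathcomp Require Import all_boot all_order all_algebra.
From mathcomp Require Import reals sequences exp.
From mathcomp Require Import zify lra.

Import Order.TTheory GRing.Theory Num.Theory.
Local Open Scope ring_scope.

(* Unqualified, [increasing_seq] is a notation of [sequences]. *)
Local Notation incr_enum := Defs.increasing_seq.
Local Notation elt A i := (nth (0 : 'F_ _) (incr_enum A) i).

(** * Integer representatives and the increasing enumeration of [A] *)

Lemma val_Fp_sub {p : nat} (u v : 'F_p) :
  (v <= u)%N -> (u - v)%R = (u - v)%N :> nat.
Proof.
move=> le_vu; have ltu := ltn_ord u; have ltv := ltn_ord v.
rewrite /= modnDmr addnBA; last exact: ltnW.
rewrite addnC -addnBA // modnDl modn_small //.
exact: leq_ltn_trans (leq_subr _ _) ltu.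
Qed.

Lemma val_Fp_add {p : nat} (u v w : 'F_p) :
  (u + v <= w)%N -> (u + v)%R = (u + v)%N :> nat.
Proof. by move=> le_uvw; rewrite /= modn_small // (leq_ltn_trans le_uvw). Qed.

Lemma size_incr_enum {p : nat} (A : {set 'F_p}) :
  size (incr_enum A) = #|A|.
Proof. by rewrite size_sort cardE. Qed.

Lemma mem_incr_enum {p : nat} (A : {set 'F_p}) (i : nat) :
  (i < #|A|)%N -> elt A i \in A.
Proof.
move=> ltiA; have := mem_nth 0 (_ : i < size (incr_enum A))%N.
by rewrite size_incr_enum mem_sort mem_enum; apply.
Qed.

Lemma ltn_incr_enum {p : nat} (A : {set 'F_p}) (i j : nat) :
  (i < j)%N -> (j < #|A|)%N -> (elt A i < elt A j)%N.
Proof.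
move=> ltij ltjA; set s := incr_enum A.
have szs : size s = #|A| := size_incr_enum A.
have ltiA := ltn_trans ltij ltjA.
have sorted_s : sorted (fun x y : 'F_p => (x <= y)%N) s.
  by apply: sort_sorted => x y; apply: leq_total.
rewrite ltn_neqAle; apply/andP; split; last first.
  by apply: (sorted_leq_nth _ _ 0 sorted_s) => //;
    rewrite ?inE ?szs ?(ltnW ltij) // => y x z; apply: leq_trans.
rewrite (inj_eq val_inj) nth_uniq ?szs //; last by rewrite sort_uniq enum_uniq.
by rewrite neq_ltn ltij.
Qed.

Lemma leq_incr_enum {p : nat} (A : {set 'F_p}) (i j : nat) :
  (i <= j)%N -> (j < #|A|)%N -> (elt A i <= elt A j)%N.
Proof.
rewrite leq_eqVlt => /predU1P[-> //|ltij] ltjA.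
exact/ltnW/ltn_incr_enum.
Qed.

(** * Cyclic ranks and windows *)

Lemma card_ord_window (n r t : nat) :
  (#|[set i : 'I_n | (i < t <= i + r)%N]| <= r)%N.
Proof.
set W := [set _ | _].
(* On [W] the value [t - i] lies between 1 and [r], so [inord] is exact there and the image misses
   [ord0]. *)
pose f (i : 'I_n) : 'I_r.+1 := inord (t - i).
have finj : {in W &, injective f}.
  move=> i j; rewrite !inE => Hi Hj /(congr1 val) /=.
  by rewrite !inordK; [move=> E; apply: val_inj => /=|..]; lia.
rewrite -(card_in_imset finj).
have : f @: W \subset [set~ ord0].
  apply/subsetP => _ /imsetP[i Hi ->].
  move: Hi; rewrite !inE => Hi; rewrite -(inj_eq val_inj) /= inordK; lia.
by move/subset_leq_card; rewrite cardsC1 card_ord.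
Qed.

(** The representative of [c - x] is the forward cyclic distance from [x] to [c]. Both endpoints are
    excluded, so the first element of [C] after [x] has rank 0. *)
Definition cyclic_rank {p : nat} (C : {set 'F_p}) (x y : 'F_p) : nat :=
  #|[set c in C | (0 < (c - x)%R < (y - x)%R)%N]|.

(** The rank strictly increases with the distance from [x]: a nearer [y] is counted in the rank of a
    farther [z] but not in its own. The point [x] is removed because it would share rank 0 with its
    successor. *)
Lemma cyclic_rank_inj {p : nat} (C : {set 'F_p}) (x : 'F_p) :
  {in C :\ x &, injective (cyclic_rank C x)}.
Proof.
have lt_rank (y z : 'F_p) : y \in C :\ x ->
    ((y - x)%R < (z - x)%R)%N ->
    (cyclic_rank C x y < cyclic_rank C x z)%N.
  rewrite 2!inE => /andP[neq_yx Cy] lt_yz; apply/proper_card/properP; split.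
    apply/subsetP => c; rewrite !inE => /and3P[-> -> lt_cy] /=.
    exact: ltn_trans lt_yz.
  exists y; rewrite !inE Cy /= ?lt_yz ?ltnn ?andbF // andbT lt0n.
  by apply: contraNneq neq_yx => yx0; rewrite -subr_eq0; apply/eqP/val_inj.
move=> y z Cy Cz eq_rank.
case: (ltngtP (y - x)%R (z - x)%R) => [lt_yz|lt_zy|/val_inj/addIr //].
  by have := lt_rank _ _ Cy lt_yz; rewrite eq_rank ltnn.
by have := lt_rank _ _ Cz lt_zy; rewrite eq_rank ltnn.
Qed.

(** Translating by [- b] turns the cyclic interval into an ordinary interval of representatives,
    with no wraparound. *)
Definition window {p : nat} (r : nat) (A C : {set 'F_p}) (i : nat) (b : 'F_p) :
    {set 'F_p} :=
  [set c in C | (elt A i < (c - b)%R <= elt A (i + r))%N].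

Lemma sum_card_window (p r : nat) (A C : {set 'F_p}) (b : 'F_p) :
  (\sum_(i < #|A| - r) #|window r A C i b| <= #|C| * r)%N.
Proof.
have -> : (\sum_(i < #|A| - r) #|window r A C i b| =
    \sum_(i < #|A| - r) \sum_(c in C) (elt A i < (c - b)%R <= elt A (i + r)))%N.
  apply: eq_bigr => i _; rewrite -sum1_card big_mkcond [RHS]big_mkcond.
  by apply: eq_bigr => c _; rewrite inE; case: (c \in C).
rewrite exchange_big /= -sum_nat_const; apply: leq_sum => c _.
set v : 'F_p := c - b.
(* [t0] is the number of elements of [A] below [v]. A window containing [c] must satisfy
   [i < t0 <= i + r]. *)
pose t0 := find (fun x : 'F_p => v <= x)%N (incr_enum A).
apply: leq_trans (card_ord_window (#|A| - r) r t0).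
rewrite -sum1_card [leqRHS]big_mkcond /=; apply: leq_sum => i _.
rewrite inE; case: (boolP (_ < v <= _)%N) => //= /andP[lt_iv le_vi].
have lt_irA : (i + r < #|A|)%N by rewrite addnC -ltn_subRL ltn_ord.
have le_t : (t0 <= i + r)%N.
  by rewrite leqNgt; apply/negP => /(before_find 0); rewrite le_vi.
suff lt_it : (i < t0)%N by rewrite lt_it le_t.
rewrite ltnNge; apply/negP => le_ti.
have has_s : has (fun x : 'F_p => v <= x)%N (incr_enum A).
  by rewrite has_find size_incr_enum (leq_ltn_trans le_t).
have lt_iA : (i < #|A|)%N := leq_ltn_trans (leq_addr r i) lt_irA.
have := nth_find 0 has_s; rewrite -/t0 leqNgt.
by rewrite (leq_ltn_trans (leq_incr_enum A t0 i le_ti lt_iA) lt_iv).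
Qed.

Lemma mem_sumset {p : nat} (A B : {set 'F_p}) a b :
  a \in A -> b \in B -> a + b \in sumset A B.
Proof. by move=> Aa Bb; apply/imset2P; exists a b. Qed.

(** The elements that the rank counts all lie in the window. The inequality is strict because the
    window also contains [elt A (i + j) + b], which the rank omits. *)
Lemma cyclic_rank_lt_window (p r : nat) (A C : {set 'F_p}) i j (b : 'F_p) :
  (0 < j)%N -> (j <= r)%N -> (i + r < #|A|)%N ->
  elt A (i + j) + b \in C ->
  (cyclic_rank C (elt A i + b)%R (elt A (i + j) + b)%R
     < #|window r A C i b|)%N.
Proof.
move=> j_gt0 le_jr lt_irA Cy.
have lt_ij : (elt A i < elt A (i + j))%N by apply: ltn_incr_enum; lia.
have le_jr' : (elt A (i + j) <= elt A (i + r))%N by apply: leq_incr_enum; lia.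
apply/proper_card/properP; split.
  apply/subsetP => c; rewrite !inE => /and3P[-> c_gt0 lt_c].
  (* This sum does not wrap around: as an integer it stays below [elt A (i + j)]. *)
  have <- : (c - (elt A i + b)) + elt A i = c - b.
    by rewrite [elt A i + b]addrC opprD addrA subrK.
  have Eyx : elt A (i + j) + b - (elt A i + b) = elt A (i + j) - elt A i.
    by rewrite opprD addrACA subrr addr0.
  move: lt_c; rewrite Eyx (val_Fp_sub _ _ (ltnW lt_ij)) ltn_subRL.
  rewrite addnC => lt_c.
  have le_c := leq_trans (ltnW lt_c) le_jr'.
  rewrite (val_Fp_add _ _ _ le_c) le_c andbT.
  by rewrite -[X in (X < _)%N]add0n ltn_add2r.
exists (elt A (i + j) + b); first by rewrite inE Cy addrK lt_ij.
by rewrite inE ltnn !andbF.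
Qed.

(** * Counting the pairs with a short window *)

Lemma leq_double_card_small (n L M : nat) (w : 'I_n -> nat) :
  (\sum_i w i <= M)%N -> (2 * M < n * L.+1)%N ->
  (n <= 2 * #|[set i | (w i <= L)%N]|)%N.
Proof.
move=> le_wM ltM; set G := [set i | _].
(* Markov's inequality: each index outside [G] contributes at least [L.+1]. *)
have : (#|~: G| * L.+1 <= M)%N.
  apply: leq_trans le_wM; rewrite -sum_nat_const big_mkcond /=.
  by apply: leq_sum => i _; rewrite !inE -ltnNge; case: ifP.
have := cardsC G; rewrite card_ord => cG.
nia.
Qed.

Definition short_pairs {p : nat} (r L : nat) (A B : {set 'F_p}) :
    {set 'F_p * 'I_(#|A| - r)} :=
  [set bi : 'F_p * 'I_(#|A| - r) |
    (bi.1 \in B) && (#|window r A (sumset A B) bi.2 bi.1| <= L)%N].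

Lemma card_short_pairs_ge (p r L : nat) (A B : {set 'F_p}) :
  (2 * (#|sumset A B| * r) < (#|A| - r) * L.+1)%N ->
  ((#|A| - r) * #|B| <= 2 * #|short_pairs r L A B|)%N.
Proof.
move=> ltL; rewrite mulnC -sum_nat_const.
have -> : #|short_pairs r L A B| = (\sum_(b in B)
    #|[set i : 'I_(#|A| - r) | (#|window r A (sumset A B) i b| <= L)%N]|)%N.
  under [RHS]eq_bigr do rewrite -sum1_card.
  rewrite pair_big_dep -sum1_card.
  by apply: eq_bigl => -[b i]; rewrite !inE.
rewrite big_distrr /=; apply: leq_sum => b _.
exact: leq_double_card_small (sum_card_window _ _ _ _ _) ltL.
Qed.

(** The first element and the [r] ranks encode a short pair injectively. The successor [L.+1] makes
    the type ['I_L.+1] of ranks inhabited, as [inord] requires. *)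
Lemma card_short_pairs_le (p r L : nat) (A B : {set 'F_p}) :
  distinct_consecutive_diffs r A ->
  (#|short_pairs r L.+1 A B| <= #|sumset A B| * L.+1 ^ r)%N.
Proof.
move=> distA; set C := sumset A B.
pose f (bi : 'F_p * 'I_(#|A| - r)) : 'F_p * {ffun 'I_r -> 'I_L.+1} :=
  (elt A bi.2 + bi.1,
   [ffun j : 'I_r => inord (cyclic_rank C (elt A bi.2 + bi.1)
                                          (elt A (bi.2 + j.+1) + bi.1))]).
have in_s (i : 'I_(#|A| - r)) j : (j <= r)%N -> (i + j < #|A|)%N.
  by have := ltn_ord i; lia.
have memC (i : 'I_(#|A| - r)) j b :
    (j <= r)%N -> b \in B -> elt A (i + j) + b \in C.
  by move=> le_jr Bb; apply/mem_sumset/Bb/mem_incr_enum/in_s.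
have memCx (i : 'I_(#|A| - r)) (j : 'I_r) b : b \in B ->
    elt A (i + j.+1) + b \in C :\ (elt A i + b).
  move=> Bb; rewrite !inE memC // andbT (inj_eq (addIr b)).
  apply/eqP => /(congr1 val)/eqP; rewrite gtn_eqF //.
  by apply: ltn_incr_enum; [lia | apply: in_s].
have lt_rank b (i : 'I_(#|A| - r)) (j : 'I_r) :
    b \in B -> (#|window r A C i b| <= L.+1)%N ->
    (cyclic_rank C (elt A i + b)%R (elt A (i + j.+1) + b)%R < L.+1)%N.
  move=> Bb; apply: leq_trans.
  by apply: cyclic_rank_lt_window => //; [apply: in_s | apply: memC].
have finj : {in short_pairs r L.+1 A B &, injective f}.
  move=> [b i] [b' i']; rewrite !inE /= => /andP[Bb leL] /andP[Bb' leL'] Ef.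
  have Ex : elt A i + b = elt A i' + b' := congr1 fst Ef.
  have Er (j : 'I_r) : cyclic_rank C (elt A i + b) (elt A (i + j.+1) + b) =
                       cyclic_rank C (elt A i' + b') (elt A (i' + j.+1) + b').
    have Ej : (f (b, i)).2 j = (f (b', i')).2 j by rewrite Ef.
    rewrite !ffunE in Ej.
    by rewrite -(inordK (lt_rank _ i _ Bb leL)) Ej inordK // lt_rank.
  have Ey j : (j <= r)%N -> elt A (i + j) + b = elt A (i' + j) + b'.
    case: j => [|j] lt_jr; first by rewrite !addn0.
    have Cy := memCx i (Ordinal lt_jr) b Bb.
    have := memCx i' (Ordinal lt_jr) b' Bb'.
    have := Er (Ordinal lt_jr).
    by rewrite -Ex => Ej Cy'; apply: cyclic_rank_inj Ej.
  (* The shifts by [b] and [b'] cancel in consecutive differences, so the hypothesis on [A]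
     applies. *)
  have Eii : i = i'.
    apply/val_inj/distA => //=; apply/eq_from_tnth => j.
    rewrite !tnth_mktuple /consecutive_diff -!addnS.
    have /= E1 := Ey j (ltnW (ltn_ord j)).
    have /= E2 := Ey j.+1 (ltn_ord j).
    rewrite -[elt A (i + j.+1)](addrK b) E2 -[elt A (i + j)](addrK b) E1.
    by rewrite -!(addrA _ b') opprD addrACA subrr addr0.
  by move: Ex; rewrite Eii => /addrI ->.
rewrite -(card_in_imset finj).
apply: leq_trans (_ : #|setX C [set: {ffun 'I_r -> 'I_L.+1}]| <= _)%N;
  last first.
  by rewrite cardsX cardsT card_ffun !card_ord.
apply/subset_leq_card/subsetP => _ /imsetP[[b i] Gbi ->].
move: Gbi; rewrite inE => /andP[/= Bb _].
by rewrite !inE andbT /= -[(i : nat)]addn0 memC.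
Qed.

(** * From the counts to the lower bound on the sumset *)

Lemma leq_card_sumset_l {p : nat} (A B : {set 'F_p}) :
  B != set0 -> (#|A| <= #|sumset A B|)%N.
Proof.
case/set0Pn => b Bb; rewrite -(card_imset A (addIr b)).
by apply/subset_leq_card/subsetP => _ /imsetP[a Aa ->]; apply: mem_sumset.
Qed.

Lemma leq_card_sumset_r {p : nat} (A B : {set 'F_p}) :
  A != set0 -> (#|B| <= #|sumset A B|)%N.
Proof.
case/set0Pn => a Aa; rewrite -(card_imset B (addrI a)).
by apply/subset_leq_card/subsetP => _ /imsetP[b Bb ->]; apply: mem_sumset.
Qed.

Lemma sumset_distinct_diffs_bound (p r : nat) (A B : {set 'F_p}) :
  (1 <= r)%N -> A != set0 -> B != set0 -> distinct_consecutive_diffs r A ->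
  (#|A| ^ r.+1 * #|B| <= (4 * r * #|sumset A B|) ^ r.+1)%N.
Proof.
move=> r_gt0 A0 B0 distA.
have := leq_card_sumset_l A _ B0; have := leq_card_sumset_r _ B A0.
set m := #|sumset A B|; set k := #|A|; set l := #|B| => le_lm le_km.
have k_gt0 : (0 < k)%N by rewrite card_gt0.
have [le_k2r|lt_2rk] := leqP k (2 * r).
  rewrite expnMn leq_mul //; first by rewrite leq_exp2r //; lia.
  rewrite expnS; apply: leq_trans le_lm _; rewrite leq_pmulr // expn_gt0.
  by rewrite (leq_trans k_gt0 le_km).
pose n := (k - r)%N; have n_gt0 : (0 < n)%N by rewrite /n; lia.
(* The least [L] allowed by the strict hypothesis of [card_short_pairs_ge]. It is positive since
   [n <= k <= m], hence a successor. *)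
pose L := (2 * (m * r) %/ n)%N.
have ltL : (2 * (m * r) < n * L.+1)%N by rewrite [(n * _)%N]mulnC ltn_ceil.
have leL : (n * L <= 2 * (m * r))%N by rewrite [(n * _)%N]mulnC leq_trunc_div.
have L_gt0 : (0 < L)%N by rewrite divn_gt0 // /n; nia.
have le_nl : (n * l <= 2 * (m * L ^ r))%N.
  apply: leq_trans (card_short_pairs_ge _ _ _ _ _ ltL) _.
  by rewrite leq_pmul2l // -(prednK L_gt0); apply: card_short_pairs_le.
(* Multiplying by [n ^ r] removes the floor, through [n * L <= 2 * (m * r)]. *)
have le_nrl : (n ^ r.+1 * l <= 2 * m * (2 * (m * r)) ^ r)%N.
  rewrite expnSr -mulnA.
  apply: leq_trans (_ : n ^ r * (2 * (m * L ^ r)) <= _)%N.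
    by rewrite leq_mul2l le_nl orbT.
  have -> : (n ^ r * (2 * (m * L ^ r)) = 2 * m * (n * L) ^ r)%N.
    by rewrite expnMn; lia.
  by rewrite leq_mul2l leq_exp2r // leL orbT.
have le_k2n : (k <= 2 * n)%N by rewrite /n; lia.
apply: leq_trans (_ : (2 * n) ^ r.+1 * l <= _)%N.
  by rewrite leq_mul2r leq_exp2r // le_k2n orbT.
rewrite expnMn -mulnA.
apply: leq_trans (_ : 2 ^ r.+1 * (2 * m * (2 * (m * r)) ^ r) <= _)%N.
  by rewrite leq_mul2l le_nrl orbT.
have -> : (2 ^ r.+1 * (2 * m * (2 * (m * r)) ^ r) = 4 * m * (4 * r * m) ^ r)%N.
  have -> : (4 * r * m = 2 * (2 * (m * r)))%N by lia.
  by rewrite expnS (expnMn 2 (2 * _)); lia.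
by rewrite [leqRHS]expnS leq_mul2r; apply/orP; right; nia.
Qed.

Theorem theorem1p3 (R : realType) :
  exists c : R, 0 < c /\
    forall (p r : nat) (A B : {set 'F_p}),
      prime p -> (1 <= r)%N -> A != set0 -> B != set0 ->
      distinct_consecutive_diffs r A ->
      sumset A B = [set: 'F_p] \/
      c * expR (- (r%:R * (ln 2 + 1))) * #|A|%:R
        * (#|B|%:R `^ (1 / r.+1%:R)) <= #|sumset A B|%:R.
Proof.
(* This cancels the 4 in [4 * r * m]; the factor [r] is left to the exponential. *)
exists (4%:R^-1); split; first by rewrite invr_gt0 ltr0n.
move=> p r A B _ r_gt0 A0 B0 distA; right.
have := sumset_distinct_diffs_bound _ _ _ _ r_gt0 A0 B0 distA.
set m := #|sumset A B|; set k := #|A|; set l := #|B| => le_kl.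
set e := expR _; set q := _ `^ _.
have e_gt0 : 0 < e by apply: expR_gt0.
have q_ge0 : 0 <= q by apply: powR_ge0.
have qX : q ^+ r.+1 = l%:R.
  by rewrite -powR_mulrn // -powRrM div1r mulVf ?pnatr_eq0 // powRr1.
have le_kq : k%:R * q <= (4 * r * m)%:R.
  rewrite -(@ler_pXn2r _ r.+1) ?nnegrE ?mulr_ge0 // exprMn qX.
  by rewrite -!natrX -natrM ler_nat.
(* The inverse of [e] is [2 ^+ r * expR r%:R], which is at least [2 ^+ r] and so exceeds [r]. *)
have re_le1 : r%:R * e <= 1.
  rewrite /e expRN ler_pdivrMr ?expR_gt0 // mul1r mulrDr mulr1 expRD.
  have -> : expR (r%:R * ln 2) = 2 ^+ r :> R.
    by rewrite mulrC expRM_natr lnK // posrE.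
  rewrite (le_trans (_ : _ <= 2 ^+ r)) //.
    by rewrite -natrX ler_nat ltnW // ltn_expl.
  by rewrite ler_peMr ?exprn_ge0 // (le_trans _ (expR_ge1Dx _)) // lerDl.
rewrite -!mulrA.
have : e * (k%:R * q) <= e * (4 * r * m)%:R by rewrite ler_pM2l.
have : r%:R * e * m%:R <= m%:R by rewrite ler_piMl.
rewrite !natrM; lra.
Qed.
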